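(* Let $\Delta = (Q,\Gamma,\delta)$ be a probabilistic pushdown automaton (pPDA) and let $g$ be its cleaned-up fundamental PPS. Then $g$ is non-singular, i.e. the matrix $I - g'(\mu g)$ is invertible, if and only if $\Delta$ is cPAST.
   Context: A pPDA $\Delta=(Q,\Gamma,\delta)$ has a finite state set $Q$, a finite stack alphabet $\Gamma$, and a finite weighted transition relation $\delta \subseteq Q\times\Gamma\times\mathbb{Q}_{\ge 0}\times Q\times\Gamma^{\le 2}$ ($\Gamma^{\le 2}$: words of length at most 2), where for each $(p,Z,q,\alpha)$ there is at most one $a$ with $(p,Z,a,q,\alpha)\in\delta$; such a transition is written $pZ \xrightarrow{a} q\alpha$. For all $pZ\in Q\times\Gamma$ one requires $\sum_{pZ\xrightarrow{a}q\alpha} a = 1$. Configurations are elements $p\gamma$ of $Q\times\Gamma^*$; each transition $pZ\xrightarrow{a}q\alpha$ and $\beta\in\Gamma^*$ yields a step $pZ\beta \to q\alpha\beta$ of probability $a$; configurations $p\varepsilon$ with empty stack have no outgoing steps. The probability of a finite path of configurations is the product of its step probabilities; its length is its number of steps. For $p,q\in Q$, $Z\in\Gamma$: $[pZ|q]$ is the sum of the probabilities of all finite paths from $pZ$ to $q\varepsilon$ (return probability), and the 1st termination moment $\mathsf{E}[pZ|q]\in[0,\infty]$ is the sum, over all these paths, of probability times length. $\Delta$ is cPAST if $\mathsf{E}[pZ|q]/[pZ|q] < \infty$ for all $p,q\in Q$, $Z\in\Gamma$ with $[pZ|q]>0$. A positive polynomial system (PPS) $f=(f_j)_{j\in J}$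 ($J$ finite) consists of polynomials with non-negative real coefficients in variables $(x_j)_{j\in J}$; as a monotone function on $[0,\infty]^J$ it has a least fixed point $\mu f$. $f'(u)$ is its Jacobi matrix evaluated at $u$. The fundamental PPS $f$ of $\Delta$ is indexed by $Q\times\Gamma\times Q$ and given by $$f_{pZq}(x)=\sum_{pZ\xrightarrow{a}q\varepsilon}a+\sum_{pZ\xrightarrow{a}rY}a\,x_{rYq}+\sum_{pZ\xrightarrow{a}rYX}a\sum_{t\in Q}x_{rYt}\,x_{tXq}.$$ It is known that $(\mu f)_{pZq}=[pZ|q]$. The cleaned-up PPS $g$ is obtained from $f$ by deleting all components $j$ with $(\mu f)_j=0$ and substituting $0$ for the corresponding variables; then $(\mu g)_j=(\mu f)_j>0$ for all remaining $j$. *)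

(* Defs.v *)
From mathcomp Require Import all_boot all_order all_algebra.
From mathcomp Require Import boolp classical_sets reals constructive_ereal ereal.
From mathcomp Require Import esum.
(* The notations of [mpoly] clash with those of MathComp-Analysis. *)
From mathcomp Require Import -(notations) mpoly.

Set Implicit Arguments.
Unset Strict Implicit.
Unset Printing Implicit Defensive.

Import Order.TTheory GRing.Theory Num.Theory.
Local Open Scope ring_scope.

Section Pushdown.
Variables (Q G : finType).

(* [delta p Z q alpha = Some a] says that p Z --a--> q alpha is a transition;
   a function into [option rat] allows at most one such a. *)
Record pPDA := PPDA {
  delta : Q -> G -> Q -> {bseq 2 of G} -> option rat;
  delta_ge0 : forall p Z q alpha a, delta p Z q alpha = Some a -> 0 <= a;
  delta_sum1 : forall p Z,
    \sum_(q : Q) \sum_(alpha : {bseq 2 of G}) odflt 0 (delta p Z q alpha) = 1 }.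

Variables (R : realType) (D : pPDA).

Definition weight (p : Q) (Z : G) (q : Q) (alpha : {bseq 2 of G}) : rat :=
  odflt 0 (delta D p Z q alpha).

Lemma weight_ge0 p Z q alpha : 0 <= weight p Z q alpha.
Proof.
rewrite /weight; case E: (delta D p Z q alpha) => [a|] //=.
exact: delta_ge0 E.
Qed.

Definition config : Type := (Q * seq G)%type.

Definition step (c c' : config) : bool :=
  if c.2 is Z :: beta then
    [exists alpha : {bseq 2 of G},
      (c'.2 == alpha ++ beta) && isSome (delta D c.1 Z c'.1 alpha)]
  else false.

(* The sum has at most one term, since alpha is determined by c and c'. *)
Definition step_prob (c c' : config) : rat :=
  if c.2 is Z :: beta then
    \sum_(alpha : {bseq 2 of G} | c'.2 == alpha ++ beta)
      weight c.1 Z c'.1 alpha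
  else 0.

Fixpoint path_prob (c : config) (w : seq config) : rat :=
  if w is c' :: w' then step_prob c c' * path_prob c' w' else 1.

(* A path from (p, Z) is represented by the sequence w of the configurations
   after the initial one, so that its length is [size w]. *)
Definition return_paths (p : Q) (Z : G) (q : Q) : set (seq (Q * seq G)) :=
  [set w | path step (p, [:: Z]) w /\ last (p, [:: Z]) w = (q, [::])]%classic.

Definition return_prob (p : Q) (Z : G) (q : Q) : \bar R :=
  (\esum_(w in return_paths p Z q) (ratr (path_prob (p, [:: Z]) w))%:E)%E.

Definition term_moment (p : Q) (Z : G) (q : Q) : \bar R :=
  (\esum_(w in return_paths p Z q)
     (ratr (path_prob (p, [:: Z]) w) * (size w)%:R)%:E)%E.

Definition cPAST : Prop :=
  forall p Z q, (0 < return_prob p Z q)%E ->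
    (term_moment p Z q / return_prob p Z q < +oo)%E.

End Pushdown.

(* Polynomials in variables indexed by a finite type J are elements of
   [mpoly #|J| R], the variable of j : J having number [enum_rank j]. *)
Section PolynomialSystems.
Variable R : realType.

Record pps (J : finType) := PPS {
  pps_poly :> J -> mpoly #|J| R;
  pps_nneg : forall j m, 0 <= mcoeff m (pps_poly j) }.

Definition pvar (J : finType) (j : J) : mpoly #|J| R :=
  mpolyX R (mnm1 (enum_rank j)).

(* Evaluation on [0, +oo], with 0 * +oo = 0 and (+oo) ^+ 0 = 1. *)
Definition eeval (n : nat) (p : mpoly n R) (x : 'I_n -> \bar R) : \bar R :=
  (\sum_(m <- msupp p) (mcoeff m p)%:E * \prod_(i < n) x i ^+ (m i))%E.

Definition pps_fun (J : finType) (f : pps J) (u : J -> \bar R) : J -> \bar R :=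
  fun j => eeval (f j) (u \o enum_val).

Definition is_lfp (J : finType) (f : pps J) (u : J -> \bar R) : Prop :=
  [/\ forall j, (0 <= u j)%E,
      pps_fun f u = u &
      forall v : J -> \bar R, (forall j, (0 <= v j)%E) -> pps_fun f v = v ->
        forall j, (u j <= v j)%E].

Lemma eeval_ge0 n (p : mpoly n R) x : (forall m, 0 <= mcoeff m p) ->
  (forall i, (0 <= x i)%E) -> (0 <= eeval p x)%E.
Proof.
move=> p0 x0; apply: sume_ge0 => m _.
apply: mule_ge0; first by rewrite lee_fin; exact: p0.
by apply: prode_ge0 => i _; exact: expe_ge0.
Qed.

Lemma eeval_le n (p : mpoly n R) x y : (forall m, 0 <= mcoeff m p) ->
  (forall i, (0 <= x i)%E) -> (forall i, (x i <= y i)%E) ->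
  (eeval p x <= eeval p y)%E.
Proof.
move=> p0 x0 xy; apply: lee_sum => m _.
apply: lee_wpmul2l; first by rewrite lee_fin; exact: p0.
suff /andP[] : (0 <= \prod_(i < n) x i ^+ m i <= \prod_(i < n) y i ^+ m i)%E
  by [].
elim/big_rec2: _ => [|i a b _ /andP[b0 ba]]; first by rewrite lee01 lexx.
have /andP[e0 exy] : (0 <= x i ^+ m i <= y i ^+ m i)%E.
  elim: (m i) => [|k /andP[k0 kxy]]; first by rewrite lee01 lexx.
  by rewrite !expeS mule_ge0 //= lee_pmul.
by rewrite mule_ge0 //= lee_pmul.
Qed.

Lemma pps_fun_ge0 (J : finType) (f : pps J) u :
  (forall j, (0 <= u j)%E) -> forall j, (0 <= pps_fun f u j)%E.
Proof. by move=> u0 j; apply: eeval_ge0 => [|i]; [exact: pps_nneg|exact: u0]. Qed.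

Lemma pps_fun_le (J : finType) (f : pps J) u v :
  (forall j, (0 <= u j)%E) -> (forall j, (u j <= v j)%E) ->
  forall j, (pps_fun f u j <= pps_fun f v j)%E.
Proof.
move=> u0 uv j.
by apply: eeval_le => [|i|i]; [exact: pps_nneg|exact: u0|exact: uv].
Qed.

Lemma lfp_exists (J : finType) (f : pps J) : exists u, is_lfp f u.
Proof.
pose S := [set v : J -> \bar R |
  (forall j, (0 <= v j)%E) /\ forall j, (pps_fun f v j <= v j)%E]%classic.
pose u j := ereal_inf [set v j | v in S]%classic.
have u0 j : (0 <= u j)%E by apply: le_ereal_inf_tmp => _ [v [v0 _] <-].
have uS v : S v -> forall j, (u j <= v j)%E.
  by move=> Sv j; apply: ereal_inf_lbound; exists v.
have fuu j : (pps_fun f u j <= u j)%E.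
  apply: le_ereal_inf_tmp => _ [v Sv <-].
  by apply: le_trans (Sv.2 j); apply: pps_fun_le => //; exact: uS.
exists u; split=> // [|v v0 fv].
  apply/funext => j; apply/le_anti; rewrite fuu /=.
  apply: uS; split=> [i|]; first exact: pps_fun_ge0.
  by apply: pps_fun_le => //; exact: pps_fun_ge0.
by apply: uS; split=> // j; rewrite fv.
Qed.

Definition mu (J : finType) (f : pps J) : J -> \bar R := sval (cid (lfp_exists f)).

Lemma muP (J : finType) (f : pps J) : is_lfp f (mu f).
Proof. exact: svalP. Qed.

Definition jacobi (J : finType) (f : pps J) (u : J -> R) : 'M[R]_#|J| :=
  \matrix_(i, j) meval (u \o enum_val) (mderiv j (f (enum_val i))).

(* Meant for systems whose least fixed point is finite, since [fine] sends
   +oo to 0; those obtained from a pPDA have their least fixed point in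
   [0, 1]. *)
Definition nonsingular (J : finType) (f : pps J) : Prop :=
  1%:M - jacobi f (fine \o mu f) \in unitmx.

Section Cleanup.
Variables (J : finType) (f : pps J).

Definition kept : finType := {j : J | mu f j != 0%E}.

Definition cleanup_subst : #|J|.-tuple (mpoly #|kept| R) :=
  [tuple if insub (enum_val i) is Some j then pvar (j : kept) else 0 | i < #|J|].

Definition cleanup_poly (j : kept) : mpoly #|kept| R :=
  comp_mpoly cleanup_subst (f (val j)).

Lemma cleanup_nneg j m : 0 <= mcoeff m (cleanup_poly j).
Proof.
move: m.
suff /mpolyOverP : cleanup_poly j \is a mpolyOver _ (@Num.Def.nneg_num_pred R)
  by [].
rewrite /cleanup_poly comp_mpolyE rpred_sum // => m _.
rewrite -mul_mpolyC rpredM //.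
  by rewrite mpolyOverC; exact: (pps_nneg f (val j) m).
rewrite rpred_prod // => i _; rewrite rpredX // tnth_mktuple.
by case: insubP => [k _ _|_]; [exact: mpolyOverX|exact: rpred0].
Qed.

Definition cleanup : pps kept := PPS cleanup_nneg.

End Cleanup.

End PolynomialSystems.

Section Fundamental.
Variables (R : realType) (Q G : finType) (D : pPDA Q G).

Notation J := (Q * G * Q)%type.

Definition fundamental_poly (j : J) : mpoly #|{: J}| R :=
  let: (p, Z, q) := j in
  let x r Y s := pvar R ((r, Y, s) : J) in
  let a r alpha : R := ratr (weight D p Z r alpha) in
  mpolyC _ (a q [bseq])
  + \sum_(r : Q) \sum_(Y : G) a r [bseq Y] *: x r Y q
  + \sum_(r : Q) \sum_(Y : G) \sum_(X : G)
      a r [bseq Y; X] *: \sum_(t : Q) x r Y t * x t X q.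

Lemma fundamental_nneg j m : 0 <= mcoeff m (fundamental_poly j).
Proof.
move: m.
suff /mpolyOverP :
    fundamental_poly j \is a mpolyOver _ (@Num.Def.nneg_num_pred R) by [].
case: j => [[p Z] q] /=.
have a0 r alpha :
    (ratr (weight D p Z r alpha) : R) \in @Num.Def.nneg_num_pred R.
  by rewrite unfold_in /= ler0q weight_ge0.
rewrite !rpredD //; first by rewrite mpolyOverC.
  do 2 rewrite rpred_sum // => ? _.
  by rewrite -mul_mpolyC rpredM ?mpolyOverC // mpolyOverX.
do 3 rewrite rpred_sum // => ? _.
rewrite -mul_mpolyC rpredM ?mpolyOverC //.
by rewrite rpred_sum // => t _; rewrite rpredM // mpolyOverX.
Qed.

Definition fundamental : pps R J := PPS fundamental_nneg.

End Fundamental.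

(* Main.v *)
(* Let T_j(n) be the probability that a return path of type j = (p, Z, q) has
   length exactly n.  Splitting a path at its first step and at the first time
   it uncovers the second stack symbol gives a quadratic convolution recurrence
   for T, i.e. W(s) = s g(W(s)) for W_j(s) = \sum_n T_j(n) s^n; moreover
   W(1) = mu g, and the moment E_j is \sum_n n T_j(n).  Write A = g'(mu g).

   If E is finite, differentiating at s = 1 yields E >= mu g + A E.  As
   mu g > 0, a vector x = A x is zero: compare at an index maximizing
   |x_j| / E_j.

   Conversely, let I - A be invertible and D = W(1) - W(s) for s < 1.  Taylor
   expansion of the quadratic map g gives
     (I - A) D = (1 - s) (W(1) - A D) - s B(D, D),
   so d = \sum_j D_j satisfies d <= M ((1 - s) + d^2).  As d tends to 0 when s
   tends to 1, this forces d = O(1 - s), which bounds the moments. *)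
Require Import Defs.
From mathcomp Require Import all_boot all_order all_algebra.
From mathcomp Require Import boolp classical_sets reals constructive_ereal.
From mathcomp Require Import ereal cardinality fsbigop esum.
From mathcomp Require Import normedtype sequences.
From mathcomp Require Import ring lra.
From mathcomp Require Import -(notations) mpoly.

Set Implicit Arguments.
Unset Strict Implicit.
Unset Printing Implicit Defensive.

Import Order.TTheory GRing.Theory Num.Theory.
Import numFieldNormedType.Exports.
Local Open Scope ring_scope.

(** * Truncated convolutions *)

Lemma sum_triangle (V : nmodType) (M : nat) (h : nat -> nat -> V) :
  \sum_(n < M) \sum_(i < n.+1) h i (n - i)%N =
  \sum_(i < M) \sum_(k < M | (i + k < M)%N) h i k.
Proof.
have inner (n : 'I_M) : \sum_(i < n.+1) h i (n - i)%N =
    \sum_(i < M) \sum_(k < M | (i + k == n)%N) h i k.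
  rewrite (big_ord_widen_cond M xpredT (fun i => h i (n - i)%N)) //.
  rewrite big_mkcond /=; apply: eq_bigr => i _.
  case: ltnP => ni; last first.
    rewrite big_pred0 // => k; apply/negbTE.
    by rewrite neq_ltn (leq_trans ni) ?orbT ?leq_addr.
  have kM : (n - i < M)%N by rewrite (leq_ltn_trans (leq_subr _ _)).
  rewrite (big_pred1 (Ordinal kM)) // => k /=.
  by rewrite -val_eqE /= -(eqn_add2l i k) subnKC // -ltnS.
rewrite (eq_bigr _ (fun n _ => inner n)) exchange_big /=.
apply: eq_bigr => i _.
rewrite (exchange_big_dep (fun k : 'I_M => (i + k < M)%N)) /=; last first.
  by move=> n k _ /eqP ->.
apply: eq_bigr => k ikM.
by rewrite (big_pred1 (Ordinal ikM)) // => n; rewrite -val_eqE /= eq_sym.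
Qed.

Section Convolution.
Variables (R : realDomainType) (w a b : nat -> R).
Hypotheses (w_ge0 : forall n, 0 <= w n).
Hypotheses (a_ge0 : forall n, 0 <= a n) (b_ge0 : forall n, 0 <= b n).

Let term i k := w (i + k)%N * (a i * b k).

Let term_ge0 i k : 0 <= term i k.
Proof. by rewrite !mulr_ge0. Qed.

Let convE M :
  \sum_(n < M) w n * \sum_(i < n.+1) a i * b (n - i)%N =
  \sum_(i < M) \sum_(k < M | (i + k < M)%N) term i k.
Proof.
rewrite -sum_triangle; apply: eq_bigr => n _; rewrite mulr_sumr.
by apply: eq_bigr => i _; rewrite /term subnKC // -ltnS.
Qed.

Lemma conv_le M :
  \sum_(n < M) w n * \sum_(i < n.+1) a i * b (n - i)%N <=
  \sum_(i < M) \sum_(k < M) w (i + k)%N * (a i * b k).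
Proof.
rewrite convE; apply: ler_sum => i _.
rewrite big_mkcond; apply: ler_sum => k _.
by case: ifP => // _; exact: term_ge0.
Qed.

(** In the square of side N one has i + k <= 2N - 2, so it fits in the triangle i + k < M when 2N <=
    M + 1. The weight [w] will be s^n for generating functions and n + 1 for moments. *)
Lemma conv_ge N M : (N + N <= M.+1)%N ->
  \sum_(i < N) \sum_(k < N) w (i + k)%N * (a i * b k) <=
  \sum_(n < M) w n * \sum_(i < n.+1) a i * b (n - i)%N.
Proof.
case: N => [|N] NM.
  rewrite big_ord0 sumr_ge0 // => n _; rewrite mulr_ge0 // sumr_ge0 // => i _.
  by rewrite mulr_ge0.
rewrite convE.
have NM' : (N.+1 <= M)%N.
  by rewrite -ltnS (leq_trans _ NM) // addSn ltnS addnS ltnS leq_addl.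
rewrite (big_ord_widen_cond M xpredT
  (fun i => \sum_(k < N.+1) w (i + k)%N * (a i * b k))) //.
rewrite big_mkcond; apply: ler_sum => i _.
case: ifP => iN; last by rewrite sumr_ge0 // => k _; exact: term_ge0.
rewrite (big_ord_widen_cond M xpredT (fun k => w (i + k)%N * (a i * b k))) //.
rewrite big_mkcond [leRHS]big_mkcond; apply: ler_sum => k _ /=.
case: ifP => kN; last by case: ifP => // _; exact: term_ge0.
case: ifP => // /negbT; rewrite -leqNgt => Mik; exfalso.
move: NM; rewrite leqNgt => /negP; apply.
rewrite ltnS in iN; rewrite ltnS in kN.
by rewrite addSn addnS !ltnS (leq_trans Mik) // leq_add.
Qed.

End Convolution.

(** * Limits of finite sums and bounds on 1 - s^n *)

Lemma cvg_sumr (R : realType) (I : finType) (u : I -> R ^nat) (l : I -> R) :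
  (forall i, u i @ \oo --> l i)%classic ->
  (\sum_i u i n @[n --> \oo] --> \sum_i l i)%classic.
Proof. by move=> ul; apply: cvg_big => // ; exact: add_continuous. Qed.

(** Here 1 - s^n = (1 - s) \sum_(i < n) s^i with summands between s^n and 1, which explains this
    bound and the next. *)
Lemma geometric_deficit_le (R : realDomainType) (s : R) n : 0 <= s <= 1 ->
  1 - s ^+ n <= n%:R * (1 - s).
Proof.
move=> /andP[s0 s1]; elim: n => [|n IH]; first by rewrite expr0 subrr mul0r.
have sn1 : s ^+ n <= 1 by rewrite exprn_ile1.
have : 0 <= (1 - s ^+ n) * (1 - s) by rewrite mulr_ge0 ?subr_ge0.
by rewrite exprS -natr1; move: (s ^+ n) (n%:R) IH => t m IH P; lra.
Qed.

Lemma geometric_deficit_ge (R : realDomainType) (s : R) n : 0 <= s <= 1 ->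
  n%:R * s ^+ n * (1 - s) <= 1 - s ^+ n.
Proof.
move=> /andP[s0 s1]; elim: n => [|n IH]; first by rewrite expr0 subrr !mul0r.
have : 0 <= (1 - s) * (1 - s ^+ n.+1).
  by rewrite mulr_ge0 ?subr_ge0 // exprn_ile1.
have := ler_wpM2l s0 IH.
rewrite exprS -natr1; move: (s ^+ n) (n%:R) => t m; lra.
Qed.

(** * Quadratic maps q and power series W with W(s) = s q(W(s)) *)

Section QuadraticSystem.
Variables (R : realType) (K : finType).
Variables (c : K -> R) (L : K -> K -> R) (B : K -> K -> K -> R).
Hypotheses (c_ge0 : forall j, 0 <= c j) (L_ge0 : forall j k, 0 <= L j k).
Hypothesis B_ge0 : forall j k l, 0 <= B j k l.

Definition qmap (x : K -> R) (j : K) : R :=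
  c j + \sum_k L j k * x k + \sum_k \sum_l B j k l * (x k * x l).

(** The Jacobi matrix of [qmap]. [B] is not assumed symmetric, so differentiating x_k x_l
    contributes both [B j k l] and [B j l k]. *)
Definition qjac (x : K -> R) (j k : K) : R :=
  L j k + \sum_l (B j k l + B j l k) * x l.

Lemma qmap_ge0 x j : (forall k, 0 <= x k) -> 0 <= qmap x j.
Proof.
move=> x0; rewrite /qmap !addr_ge0 // sumr_ge0 // => k _.
  by rewrite mulr_ge0.
by rewrite sumr_ge0 // => l _; rewrite !mulr_ge0.
Qed.

Lemma qjac_ge0 x j k : (forall k, 0 <= x k) -> 0 <= qjac x j k.
Proof.
move=> x0; rewrite addr_ge0 // sumr_ge0 // => l _.
by rewrite mulr_ge0 // addr_ge0.
Qed.

Lemma qmap_le x y j : (forall k, 0 <= x k) -> (forall k, x k <= y k) ->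
  qmap x j <= qmap y j.
Proof.
move=> x0 xy; rewrite /qmap !lerD //.
  by apply: ler_sum => k _; rewrite ler_wpM2l.
by apply: ler_sum => k _; apply: ler_sum => l _; rewrite ler_wpM2l // ler_pM.
Qed.

(** Swapping the indices in the [B j l k] half leaves one coefficient [B j k l]; this is the
    product-rule shape needed in [moment_ge]. *)
Lemma qjac_sum x y j : \sum_k qjac x j k * y k =
  \sum_k L j k * y k + \sum_k \sum_l B j k l * (y k * x l + x k * y l).
Proof.
under eq_bigr => k _ do rewrite mulrDl mulr_suml.
rewrite big_split /=; congr (_ + _).
under eq_bigr => k _.
  under eq_bigr => l _ do rewrite mulrDl mulrDl.
  rewrite big_split /=.
  over.
rewrite big_split /=.
rewrite [X in _ + X]exchange_big -big_split /=.
apply: eq_bigr => k _; rewrite -big_split /=.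
by apply: eq_bigr => l _; ring.
Qed.

(** Exact, as [qmap] has degree 2. Centring at [x] gives the quadratic term its minus sign. *)
Lemma qmap_taylor x y j : qmap x j - qmap y j =
  \sum_k qjac x j k * (x k - y k)
  - \sum_k \sum_l B j k l * ((x k - y k) * (x l - y l)).
Proof.
rewrite qjac_sum /qmap.
have cancel_c (a p q r t : R) : a + p + q - (a + r + t) = (p - r) + (q - t).
  by ring.
rewrite cancel_c -[RHS]addrA -!sumrB; congr (_ + _).
  by apply: eq_bigr => k _; ring.
apply: eq_bigr => k _; rewrite -!sumrB.
by apply: eq_bigr => l _; ring.
Qed.

Lemma qmap_cvg (u : nat -> K -> R) (l : K -> R) j :
  (forall k, u n k @[n --> \oo] --> l k)%classic ->
  (qmap (u n) j @[n --> \oo] --> qmap l j)%classic.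
Proof.
move=> ul; apply: cvgD; first apply: cvgD; first exact: cvg_cst.
  by apply: cvg_sumr => k; apply: cvgM => //; exact: cvg_cst.
apply: cvg_sumr => k; apply: cvg_sumr => m; apply: cvgM; first exact: cvg_cst.
exact: cvgM.
Qed.

Lemma qjac_cvg (u v : nat -> K -> R) (l m : K -> R) j :
  (forall k, u n k @[n --> \oo] --> l k)%classic ->
  (forall k, v n k @[n --> \oo] --> m k)%classic ->
  (\sum_k qjac (u n) j k * v n k @[n --> \oo] -->
   \sum_k qjac l j k * m k)%classic.
Proof.
move=> ul vm; apply: cvg_sumr => k; apply: cvgM => //.
apply: cvgD; first exact: cvg_cst.
by apply: cvg_sumr => i; apply: cvgM => //; exact: cvg_cst.
Qed.

Variable T : nat -> K -> R.
Hypothesis T_ge0 : forall n j, 0 <= T n j.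
Hypothesis T0 : forall j, T 0%N j = 0.
Hypothesis TS : forall n j, T n.+1 j = (if n is 0%N then c j else 0)
  + \sum_k L j k * T n k
  + \sum_k \sum_l B j k l * \sum_(i < n.+1) T i k * T (n - i)%N l.

Definition psum (s : R) (N : nat) (j : K) : R := \sum_(n < N) s ^+ n * T n j.

Definition moment (N : nat) (j : K) : R := \sum_(n < N) n%:R * T n j.

(** By linearity any weight on lengths passes through the recurrence; s^n serves [psum], n + 1
    serves [moment]. *)
Lemma weighted_rec (w : nat -> R) M j :
  \sum_(n < M.+1) w n * T n.+1 j = w 0%N * c j
  + \sum_k L j k * (\sum_(n < M.+1) w n * T n k)
  + \sum_k \sum_l B j k l *
      (\sum_(n < M.+1) w n * \sum_(i < n.+1) T i k * T (n - i)%N l).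
Proof.
under eq_bigr => n _ do rewrite TS !mulrDr.
rewrite !big_split /=; congr (_ + _ + _).
- by rewrite big_ord_recl /= big1 ?addr0 // => i _; rewrite mulr0.
- under [RHS]eq_bigr => k _ do rewrite mulr_sumr.
  rewrite exchange_big /=; apply: eq_bigr => n _; rewrite mulr_sumr.
  by apply: eq_bigr => k _; ring.
- under [RHS]eq_bigr => k _ do
    (under eq_bigr => l _ do rewrite mulr_sumr; rewrite exchange_big).
  rewrite exchange_big /=; apply: eq_bigr => n _; rewrite mulr_sumr.
  apply: eq_bigr => k _; rewrite mulr_sumr; apply: eq_bigr => l _; ring.
Qed.

Lemma psum0 s j : psum s 0 j = 0. Proof. by rewrite /psum big_ord0. Qed.

Section PartialSums.
Variable s : R.
Hypothesis s_ge0 : 0 <= s.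

Lemma psum_ge0 N j : 0 <= psum s N j.
Proof. by rewrite sumr_ge0 // => n _; rewrite mulr_ge0 // exprn_ge0. Qed.

Lemma psum_homo j : {homo psum s ^~ j : n m / (n <= m)%N >-> n <= m}.
Proof.
apply/nondecreasing_seqP => n; rewrite /psum big_ord_recr /= lerDl.
by rewrite mulr_ge0 // exprn_ge0.
Qed.

Let psumS N j : psum s N.+1 j = s * \sum_(n < N) s ^+ n * T n.+1 j.
Proof.
rewrite /psum big_ord_recl /= T0 mulr0 add0r mulr_sumr.
by apply: eq_bigr => n _; rewrite exprS mulrA.
Qed.

Let prodE N k l : psum s N k * psum s N l =
  \sum_(i < N) \sum_(m < N) s ^+ (i + m) * (T i k * T m l).
Proof.
rewrite /psum mulr_suml; apply: eq_bigr => i _; rewrite mulr_sumr.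
by apply: eq_bigr => m _; rewrite exprD; ring.
Qed.

(** The product of partial sums also contains the pairs with i + k >= N, which truncation on the
    left drops. *)
Lemma psum_le_qmap N j : psum s N.+1 j <= s * qmap (psum s N) j.
Proof.
rewrite psumS ler_wpM2l //; case: N => [|N].
  by rewrite big_ord0 qmap_ge0 // => k; exact: psum_ge0.
rewrite (weighted_rec (GRing.exp s)) expr0 mul1r /qmap !lerD //.
apply: ler_sum => k _; apply: ler_sum => l _; rewrite ler_wpM2l // prodE.
by apply: (@conv_le _ (GRing.exp s) (T ^~ k) (T ^~ l)) => // n;
  rewrite exprn_ge0.
Qed.

(** The square of side N fits in the triangle of side 2N + 1, and the factor s shifts the order by
    one more. *)
Lemma qmap_le_psum N j : s * qmap (psum s N) j <= psum s (N + N).+2 j.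
Proof.
rewrite [leRHS]psumS ler_wpM2l // (weighted_rec (GRing.exp s)) expr0 mul1r.
rewrite /qmap !lerD //.
  apply: ler_sum => k _; rewrite ler_wpM2l //.
  by apply: psum_homo; rewrite -addnS leq_addr.
apply: ler_sum => k _; apply: ler_sum => l _; rewrite ler_wpM2l // prodE.
by apply: (@conv_ge _ (GRing.exp s) (T ^~ k) (T ^~ l)) => // [n|];
  rewrite ?exprn_ge0 // leqW.
Qed.

End PartialSums.

Lemma moment_ge0 N j : 0 <= moment N j.
Proof. by rewrite sumr_ge0 // => n _; rewrite mulr_ge0. Qed.

Lemma moment_homo j : {homo moment ^~ j : n m / (n <= m)%N >-> n <= m}.
Proof.
apply/nondecreasing_seqP => n.
by rewrite /moment big_ord_recr /= lerDl mulr_ge0.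
Qed.

(* Truncated derivative at s = 1 of W(s) = s * qmap (W(s)). *)
Lemma moment_ge N j :
  qmap (psum 1 N) j + \sum_k qjac (psum 1 N) j k * moment N k <=
  moment (N + N).+2 j.
Proof.
have -> : moment (N + N).+2 j =
    \sum_(n < (N + N).+1) (n%:R + 1) * T n.+1 j.
  rewrite /moment big_ord_recl mul0r add0r.
  by apply: eq_bigr => n _; rewrite /= /bump add1n -natr1.
rewrite (weighted_rec (fun n => n%:R + 1)) add0r mul1r qjac_sum /qmap.
(* The weight n + 1 on the right is used in two parts: 1 yields [qmap], n yields the derivative. *)
rewrite addrACA -[X in X + _ <= _]addrA -!big_split /= lerD //.
  rewrite lerD2l; apply: ler_sum => k _; rewrite -mulrDr ler_wpM2l //.
  have -> : \sum_(n < (N + N).+1) (n%:R + 1) * T n k =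
      moment (N + N).+1 k + psum 1 (N + N).+1 k.
    rewrite -big_split /=; apply: eq_bigr => n _.
    by rewrite expr1n mulrDl.
  rewrite addrC lerD //; first by apply: moment_homo; rewrite -addnS leq_addr.
  by apply: psum_homo => //; rewrite -addnS leq_addr.
apply: ler_sum => k _; rewrite -big_split /=; apply: ler_sum => l _.
rewrite -mulrDr ler_wpM2l //.
(* The weight i + m + 1 of a product splits as in the product rule: a moment on either factor, plus
   the plain product. *)
have := @conv_ge R (fun n => n%:R + 1) (T ^~ k) (T ^~ l) _ _ _ N (N + N).+1.
move/(_ (fun n => addr_ge0 (ler0n _ n) ler01) (T_ge0 ^~ k) (T_ge0 ^~ l)).
move/(_ (leqW (leqnSn _))).
apply: le_trans; rewrite le_eqVlt; apply/orP; left; apply/eqP.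
rewrite /psum /moment !mulr_suml -!big_split /=; apply: eq_bigr => i _.
rewrite !mulr_sumr -!big_split /=; apply: eq_bigr => m _.
by rewrite !expr1n natrD; ring.
Qed.

Hypothesis psum_le1 : forall N j, psum 1 N j <= 1.

Definition wsum (s : R) (j : K) : R := limn (psum s ^~ j).

Section Limit.
Variable s : R.
Hypotheses (s_ge0 : 0 <= s) (s_le1 : s <= 1).

Lemma psum_le_psum1 N j : psum s N j <= psum 1 N j.
Proof.
by apply: ler_sum => n _; rewrite ler_wpM2r // expr1n exprn_ile1.
Qed.

Lemma psum_cvg j : (psum s ^~ j @ \oo --> wsum s j)%classic.
Proof.
apply: nondecreasing_is_cvgn; first exact: psum_homo.
by exists 1 => _ [N _ <-]; exact: le_trans (psum_le_psum1 _ _) (psum_le1 _ _).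
Qed.

Lemma psum_le_wsum N j : psum s N j <= wsum s j.
Proof.
apply: nondecreasing_cvgn_le; first exact: psum_homo.
exact: psum_cvg.
Qed.

Lemma wsum_ge0 j : 0 <= wsum s j.
Proof. by apply: le_trans (psum_le_wsum 0 j); rewrite psum0. Qed.

Lemma wsum_le x j : (forall N, psum s N j <= x) -> wsum s j <= x.
Proof.
move=> Sx; apply: (ler_cvg_to (@psum_cvg j) (cvg_cst x)).
exact: nearW.
Qed.

(** [psum_le_qmap] and [qmap_le_psum] squeeze the limit from both sides. *)
Lemma wsum_fix j : wsum s j = s * qmap (wsum s) j.
Proof.
apply/le_anti/andP; split.
  apply: wsum_le => -[|N].
    by rewrite psum0 mulr_ge0 // qmap_ge0 // => k; exact: wsum_ge0.
  apply: le_trans (psum_le_qmap s_ge0 N j) _; rewrite ler_wpM2l //.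
  by apply: qmap_le => k; [exact: psum_ge0|exact: psum_le_wsum].
have cv : (s * qmap (psum s n) j @[n --> \oo] --> s * qmap (wsum s) j)%classic.
  by apply: cvgM; [exact: cvg_cst|exact: qmap_cvg psum_cvg].
apply: (ler_cvg_to cv (cvg_cst (wsum s j))).
apply: nearW => N; exact: le_trans (qmap_le_psum s_ge0 N j) (psum_le_wsum _ _).
Qed.

End Limit.

Let W := wsum 1.

Lemma wsum1_le1 j : W j <= 1.
Proof. by apply: wsum_le => // N. Qed.

(** The limits [E] of the moments satisfy E >= W + A E with A = qjac W and W > 0. Hence A strictly
    contracts the norm max_j |x_j| / E_j, and x = A x forces x = 0. *)
Lemma qjac_kernel_trivial (C : K -> R) (x : K -> R) :
  (forall j, 0 < W j) -> (forall N j, moment N j <= C j) ->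
  (forall j, x j = \sum_k qjac W j k * x k) -> forall j, x j = 0.
Proof.
move=> W0 MC xE.
pose E j := limn (moment ^~ j).
have Mcvg j : (moment ^~ j @ \oo --> E j)%classic.
  apply: nondecreasing_is_cvgn; first exact: moment_homo.
  by exists (C j) => _ [N _ <-].
have ME N j : moment N j <= E j.
  by apply: nondecreasing_cvgn_le; [exact: moment_homo|exact: Mcvg].
(* This is the limit of [moment_ge], with qmap W = W. *)
have EW j : W j + \sum_k qjac W j k * E k <= E j.
  have -> : W j = qmap W j by rewrite /W {1}wsum_fix // mul1r.
  have cv : (qmap (psum 1 n) j + \sum_k qjac (psum 1 n) j k * moment n k
      @[n --> \oo] --> qmap W j + \sum_k qjac W j k * E k)%classic.
    apply: cvgD; first by apply: qmap_cvg => k; exact: psum_cvg.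
    by apply: qjac_cvg => k //; exact: psum_cvg.
  apply: (ler_cvg_to cv (cvg_cst (E j))).
  by apply: nearW => N; exact: le_trans (moment_ge N j) (ME _ _).
have W00 j : 0 <= W j by exact: ltW.
have E0 j : 0 < E j.
  apply: lt_le_trans (EW j); rewrite ltr_pwDl // sumr_ge0 // => k _.
  rewrite mulr_ge0 ?qjac_ge0 //.
  by apply: le_trans (ME 0%N k); rewrite moment_ge0.
move=> j0.
have [i _ imax] := @arg_maxP _ _ _ j0 xpredT (fun k => `|x k| / E k) isT.
set m := `|x i| / E i in imax.
have xm k : `|x k| <= m * E k by rewrite -ler_pdivrMr //; exact: imax.
(* Otherwise |x_i| <= m (A E)_i <= m (E_i - W_i) < m E_i = |x_i|. *)
have m0 : m <= 0.
  rewrite leNgt; apply/negP => m_gt0.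
  have : `|x i| <= m * (E i - W i).
    rewrite {1}xE (le_trans (ler_norm_sum _ _ _)) //.
    apply: (@le_trans _ _ (m * \sum_k qjac W i k * E k)).
      rewrite mulr_sumr; apply: ler_sum => k _.
      by rewrite normrM ger0_norm ?qjac_ge0 // mulrCA ler_wpM2l ?qjac_ge0.
    by rewrite ler_pM2l // lerBrDl.
  have -> : `|x i| = m * E i by rewrite /m divfK // gt_eqF.
  by rewrite ler_pM2l // lerBrDr gerDl lt_geF.
apply/eqP; rewrite -normr_le0 (le_trans (xm j0)) //.
by rewrite mulr_le0_ge0 // ltW.
Qed.

(** Left continuity at 1: some partial sum captures W(1) up to e/2, and a partial sum of N terms
    changes by at most N (1 - s) in each component. *)
Lemma wsum_deficit (e : R) : 0 < e -> exists2 d, 0 < d &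
  forall s, 0 <= s <= 1 -> 1 - d <= s -> \sum_j (W j - wsum s j) <= e.
Proof.
move=> e0.
have Wcvg : (\sum_j psum 1 n j @[n --> \oo] --> \sum_j W j)%classic.
  by apply: cvg_sumr => j; exact: psum_cvg.
have := cvgr_gt _ Wcvg (\sum_j W j - e / 2).
case=> [|N _ /(_ N (leqnn N)) /= WN]; first by rewrite gtrBl divr_gt0.
have D0 : 0 < (N * #|K|)%:R + 1 :> R by rewrite ltr_wpDl.
(* The added 1 keeps the divisor positive when N or [#|K|] is 0. *)
exists (e / 2 / ((N * #|K|)%:R + 1)); first by rewrite !divr_gt0.
move=> s s01 ds; have /andP[s0 s1] := s01.
have : \sum_j (psum 1 N j - psum s N j) <= e / 2.
  apply: (@le_trans _ _ (\sum_(j : K) N%:R * (1 - s))).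
    apply: ler_sum => j _.
    have N0 : 0 <= N%:R * (1 - s) by rewrite mulr_ge0 ?subr_ge0.
    apply: (@le_trans _ _ (N%:R * (1 - s) * psum 1 N j)); last first.
      by rewrite ler_piMr.
    rewrite /psum -sumrB mulr_sumr; apply: ler_sum => n _.
    rewrite expr1n mul1r -{1}[T n j]mul1r -mulrBl ler_wpM2r //.
    apply: le_trans (geometric_deficit_le n s01) _.
    by rewrite ler_wpM2r ?subr_ge0 // ler_nat ltnW.
  rewrite sumr_const -[_ *+ _]mulr_natl mulrA -natrM mulnC.
  have : 1 - s <= e / 2 / ((N * #|K|)%:R + 1) by lra.
  rewrite ler_pdivlMr // mulrC; apply: le_trans.
  by rewrite mulrDl lerDl mul1r subr_ge0.
have : \sum_j psum s N j <= \sum_j wsum s j.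
  by apply: ler_sum => j _; exact: psum_le_wsum.
by rewrite !sumrB; lra.
Qed.

(** [V] acts as a left inverse of I - A with A = qjac W. The deficit W(1) - W(s) is first shown to
    be O(1 - s); evaluated at an s close to 1 depending on N, it then bounds the moment truncated at
    N, uniformly in N. *)
Lemma moment_bounded (V : K -> K -> R) :
  (forall x i, x i = \sum_j V i j * (x j - \sum_k qjac W j k * x k)) ->
  exists C, forall N j, moment N j <= C.
Proof.
move=> VP.
pose A1 j := \sum_k qjac W j k.
pose B1 j := \sum_k \sum_l B j k l.
(* [c0] will bound the residual (I - A) D, and M carries this bound through [V]; the 1 added in M
   makes it positive. *)
pose c0 j := 1 + A1 j + B1 j.
pose M := 1 + \sum_i \sum_j `|V i j| * c0 j.
have W00 j : 0 <= W j by exact: wsum_ge0.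
have A10 j : 0 <= A1 j by rewrite sumr_ge0 // => k _; exact: qjac_ge0.
have B10 j : 0 <= B1 j by rewrite sumr_ge0 // => k _; rewrite sumr_ge0.
have M1 : 1 <= M.
  rewrite lerDl sumr_ge0 // => i _; rewrite sumr_ge0 // => j _.
  by rewrite mulr_ge0 // !addr_ge0.
have M0 : 0 < M by exact: lt_le_trans M1.
(* Within distance d of 1 the total deficit t satisfies 2 M t <= 1, which selects the small branch
   of the quadratic inequality. *)
have [d d0 dP] : exists2 d, 0 < d &
  forall s, 0 <= s <= 1 -> 1 - d <= s -> \sum_j (W j - wsum s j) <= (2 * M)^-1.
  by apply: wsum_deficit; rewrite invr_gt0 mulr_gt0.
have bound s : 0 <= s < 1 -> 1 - d <= s ->
    \sum_j (W j - wsum s j) <= 2 * M * (1 - s).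
  move=> /andP[s0 /ltW s1] ds.
  pose D j := W j - wsum s j.
  have D0 j : 0 <= D j.
    rewrite subr_ge0; apply: wsum_le => // N.
    by apply: le_trans (psum_le_psum1 _ _ _ _) (psum_le_wsum _ _ _ _).
  set t := \sum_j D j.
  have Dt j : D j <= t by rewrite /t (bigD1 j) //= lerDl sumr_ge0.
  have t0 : 0 <= t by rewrite sumr_ge0.
  have D1 j : D j <= 1.
    by rewrite lerBlDr (le_trans (wsum1_le1 j)) // lerDl wsum_ge0.
  have tM : t * (2 * M) <= 1.
    by rewrite -ler_pdivlMr ?mulr_gt0 // mul1r dP // s0.
  have res j : `|D j - \sum_k qjac W j k * D k| <= c0 j * ((1 - s) + t ^+ 2).
    pose AD := \sum_k qjac W j k * D k.
    pose BD := \sum_k \sum_l B j k l * (D k * D l).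
    have AD0 : 0 <= AD.
      by rewrite sumr_ge0 // => k _; rewrite mulr_ge0 // qjac_ge0.
    have ADle : AD <= A1 j.
      by apply: ler_sum => k _; rewrite ler_piMr // qjac_ge0.
    have BD0 : 0 <= BD.
      rewrite sumr_ge0 // => k _; rewrite sumr_ge0 // => l _.
      by rewrite !mulr_ge0.
    have BDle : BD <= B1 j * t ^+ 2.
      rewrite mulr_suml; apply: ler_sum => k _; rewrite mulr_suml.
      by apply: ler_sum => l _; rewrite ler_wpM2l // expr2 ler_pM.
    (* Subtract W(s) = s q(W(s)) from W(1) = q(W(1)) and expand q(W(1)) - q(W(s)) at W(1). *)
    have DE : D j - AD = (1 - s) * (W j - AD) - s * BD.
      have Ts : qmap W j - qmap (wsum s) j = AD - BD by exact: qmap_taylor.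
      have Fs : wsum s j = s * qmap (wsum s) j by exact: wsum_fix.
      have F1 : W j = qmap W j by rewrite /W {1}wsum_fix // mul1r.
      rewrite -F1 in Ts; rewrite /D Fs.
      have -> : qmap (wsum s) j = W j - AD + BD by lra.
      by ring.
    have W1 := wsum1_le1 j.
    rewrite DE (le_trans (ler_normB _ _)) // [leRHS]mulrDr lerD //.
      rewrite normrM ger0_norm ?subr_ge0 // mulrC ler_wpM2r ?subr_ge0 //.
      rewrite ler_norml /c0; have := B10 j; have := W00 j; have := A10 j; lra.
    rewrite normrM !ger0_norm //.
    apply: (@le_trans _ _ BD); first by rewrite ler_piMl.
    apply: le_trans BDle _; rewrite ler_wpM2r ?exprn_ge0 //.
    by rewrite /c0; have := A10 j; lra.
  have : t <= M * ((1 - s) + t ^+ 2).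
    have r0 : 0 <= (1 - s) + t ^+ 2 by rewrite addr_ge0 ?subr_ge0 ?exprn_ge0.
    apply: (@le_trans _ _
      ((\sum_i \sum_j `|V i j| * c0 j) * ((1 - s) + t ^+ 2))); last first.
      by rewrite ler_wpM2r // lerDr.
    rewrite mulr_suml; apply: ler_sum => i _.
    rewrite mulr_suml (VP D i) (le_trans (ler_norm _)) //.
    rewrite (le_trans (ler_norm_sum _ _ _)) //; apply: ler_sum => j _.
    by rewrite normrM -mulrA ler_wpM2l.
  (* As 2 M t <= 1, the term M t^2 is at most t / 2 and is absorbed on the left. *)
  by move: M0 t0 tM; rewrite -/t; move: (t) => u; nra.
(* The deficit bound gives 2 M, and s^N >= 1/2 costs another factor 2. *)
exists (4 * M) => N j.
(* Close enough to 1 for [bound], and with N (1 - s) <= 1/2, so that s^N >= 1/2. *)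
pose s := Num.max (1 - d) (1 - (2 * (N%:R + 1))^-1).
have N10 : 0 < 2 * (N%:R + 1) :> R by rewrite mulr_gt0 // ltr_wpDl.
have N1 : (2 * (N%:R + 1))^-1 <= 1 :> R.
  by rewrite invf_le1 // -natr1; have : 0 <= N%:R :> R by []; lra.
have sN : 1 - s <= (2 * (N%:R + 1))^-1.
  by rewrite lerBlDr -lerBlDl /s le_max lexx orbT.
have s0 : 0 <= s by rewrite /s le_max; apply/orP; right; lra.
have s1 : s < 1.
  by rewrite /s gt_max !gtrBl d0 invr_gt0.
have /(_ _ _)/= := bound s; rewrite s0 s1 => /(_ isT).
rewrite {1}/s le_max lexx => /(_ isT) Ws.
have s1' : s <= 1 by exact: ltW.
have s01 : 0 <= s <= 1 by rewrite s0 s1'.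
have half : 1 / 2 <= s ^+ N.
  have := geometric_deficit_le N s01.
  have : N%:R * (1 - s) <= N%:R * (2 * (N%:R + 1))^-1 by rewrite ler_wpM2l.
  have : N%:R * (2 * (N%:R + 1))^-1 <= 1 / 2 :> R.
    by rewrite ler_pdivrMr // mulrA divfK // mul1r lerDl.
  lra.
have D0 k : 0 <= W k - wsum s k.
  rewrite subr_ge0; apply: wsum_le => // n.
  by apply: le_trans (psum_le_psum1 _ _ _ _) (psum_le_wsum _ _ _ _).
have Wj : W j - wsum s j <= 2 * M * (1 - s).
  by apply: le_trans Ws; rewrite (bigD1 j) //= lerDl sumr_ge0.
have tail : psum 1 N j - psum s N j <= W j - wsum s j.
  have cv : (psum 1 n j - psum s n j @[n --> \oo] --> W j - wsum s j)%classic.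
    by apply: cvgB; apply: psum_cvg.
  apply: (ler_cvg_to (cvg_cst _) cv); exists N => // n /= Nn.
  rewrite /psum -!sumrB.
  rewrite -!(big_mkord xpredT (fun i => 1 ^+ i * T i j - s ^+ i * T i j)).
  rewrite (big_cat_nat (n := N) _ Nn) //= lerDl sumr_ge0 // => i _.
  by rewrite expr1n subr_ge0 ler_wpM2r // exprn_ile1.
(* For n < N, n s^N (1 - s) <= n s^n (1 - s) <= 1 - s^n. *)
have : moment N j * (s ^+ N * (1 - s)) <= 2 * M * (1 - s).
  apply: le_trans (le_trans tail Wj).
  rewrite mulr_suml -sumrB; apply: ler_sum => n _.
  rewrite expr1n -mulrBl [_ * T n j]mulrC -mulrA [leRHS]mulrC ler_wpM2l //.
  apply: le_trans (geometric_deficit_ge n s01).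
  rewrite -mulrA ler_wpM2l // ler_wpM2r ?subr_ge0 //.
  by apply: ler_wiXn2l => //; exact: ltnW.
rewrite mulrA ler_pM2r ?subr_gt0 //.
by have := moment_ge0 N j; nra.
Qed.

End QuadraticSystem.

(** * Quadratic polynomials: evaluation and derivatives *)

Lemma eeval_EFin (R : realType) n (p : mpoly n R) (x : 'I_n -> R) :
  eeval p (EFin \o x) = (meval x p)%:E.
Proof.
rewrite /eeval mevalE -sumEFin; apply: eq_bigr => m _.
rewrite EFinM -prodEFin; congr (_ * _)%E; apply: eq_bigr => i _.
by rewrite EFin_expe.
Qed.

Section QuadraticPolynomials.
Variables (R : realType) (J : finType).
Variables (c : J -> R) (L : J -> J -> R) (B : J -> J -> J -> R).

Definition quad_mpoly (j : J) : mpoly #|J| R :=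
  mpolyC _ (c j) + \sum_k L j k *: pvar R k
  + \sum_k \sum_l B j k l *: (pvar R k * pvar R l).

Lemma meval_pvar (x : J -> R) (k : J) : meval (x \o enum_val) (pvar R k) = x k.
Proof. by rewrite /pvar mevalXU /= enum_rankK. Qed.

Lemma mderiv_pvar i (k : J) :
  mderiv i (pvar R k) = mpolyC _ (i == enum_rank k)%:R.
Proof.
rewrite /pvar mderivX mnm1E eq_sym.
case: eqP => [->|_]; last by rewrite scale0r mpolyC0.
rewrite scale1r [X in mpolyX _ X](_ : _ = mnm0) ?mpolyX0 //.
by apply/mnmP => m; rewrite mnmBE subnn mnm0E.
Qed.

Lemma meval_quad_mpoly (x : J -> R) j :
  meval (x \o enum_val) (quad_mpoly j) = qmap c L B x j.
Proof.
rewrite /quad_mpoly /qmap !mevalD mevalC !raddf_sum /=; congr (_ + _ + _).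
  by apply: eq_bigr => k _; rewrite mevalZ meval_pvar.
apply: eq_bigr => k _; rewrite raddf_sum /=; apply: eq_bigr => l _.
by rewrite mevalZ mevalM !meval_pvar.
Qed.

Lemma meval_mderiv_quad_mpoly (x : J -> R) j k :
  meval (x \o enum_val) (mderiv (enum_rank k) (quad_mpoly j)) = qjac L B x j k.
Proof.
have deltaE l : (enum_rank k == enum_rank l)%:R = (l == k)%:R :> R.
  by rewrite (inj_eq enum_rank_inj) eq_sym.
rewrite /quad_mpoly /qjac !mderivD mderivC add0r !raddf_sum /= mevalD.
congr (_ + _).
  rewrite raddf_sum /= (bigD1 k) //= big1 ?addr0.
    by rewrite mderivZ mevalZ mderiv_pvar mevalC deltaE eqxx mulr1.
  move=> l /negPf lk.
  by rewrite mderivZ mevalZ mderiv_pvar mevalC deltaE lk mulr0.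
(* The product rule gives one term for l = k and one for m = k, the two halves of [qjac]. *)
have termE l m : meval (x \o enum_val)
      (mderiv (enum_rank k) (B j l m *: (pvar R l * pvar R m))) =
    (l == k)%:R * (B j l m * x m) + (m == k)%:R * (B j l m * x l).
  rewrite mderivZ mevalZ mderivM mevalD !mevalM !mderiv_pvar !mevalC.
  by rewrite !meval_pvar !deltaE; ring.
rewrite raddf_sum /=.
have rowE l : meval (x \o enum_val) (mderiv (enum_rank k)
      (\sum_m B j l m *: (pvar R l * pvar R m))) =
    \sum_m (l == k)%:R * (B j l m * x m) + \sum_m (m == k)%:R * (B j l m * x l).
  rewrite (raddf_sum (mderiv _)) (raddf_sum (meval _)) -big_split.
  by apply: eq_bigr => m _; exact: termE.
rewrite (eq_bigr _ (fun l _ => rowE l)).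
rewrite big_split /=; under [RHS]eq_bigr => l _ do rewrite mulrDl.
rewrite big_split /=; congr (_ + _).
  rewrite (bigD1 k) //= [X in _ + X]big1 ?addr0.
    by apply: eq_bigr => l _; rewrite eqxx mul1r.
  by move=> l /negPf lk; rewrite big1 // => m _; rewrite lk mul0r.
apply: eq_bigr => l _; rewrite (bigD1 k) //= big1 ?addr0 ?eqxx ?mul1r //.
by move=> m /negPf mk; rewrite mk mul0r.
Qed.

End QuadraticPolynomials.

(** * Cleanup of quadratic systems *)

Lemma sum_kept (R : realType) (J : finType) (f : pps R J) (V : nmodType)
    (F : J -> V) : (forall k, mu f k = 0%E -> F k = 0) ->
  \sum_k F k = \sum_(i : kept f) F (val i).
Proof.
move=> F0; rewrite -(big_sub_cond (fun k => mu f k != 0%E) xpredT) /=.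
rewrite [LHS](bigID (fun k => mu f k != 0%E)) /= [X in _ + X]big1 ?addr0.
  by apply: eq_bigl => k; rewrite andbT.
by move=> k; rewrite negbK => /eqP /F0.
Qed.

(** Setting deleted variables to 0 kills every monomial with a deleted index, so the system stays
    quadratic with restricted coefficients. *)
Lemma cleanup_quad_mpoly (R : realType) (J : finType) (f : pps R J) c L B :
  (forall j, f j = quad_mpoly c L B j) ->
  forall j : kept f, cleanup f j =
    quad_mpoly (fun i => c (val i)) (fun i k => L (val i) (val k))
      (fun i k l => B (val i) (val k) (val l)) j.
Proof.
move=> fE j.
have substE k : comp_mpoly (cleanup_subst f) (pvar R k) =
    if insub k is Some i then pvar R (i : kept f) else 0.
  by rewrite /pvar comp_mpolyXU -tnth_nth tnth_mktuple enum_rankK.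
have keptE (i : kept f) : insub (val i) = Some i :> option (kept f).
  by rewrite valK.
have subst0 k : mu f k = 0%E -> comp_mpoly (cleanup_subst f) (pvar R k) = 0.
  by move=> k0; rewrite substE insubF // k0 eqxx.
rewrite /= /cleanup_poly fE /quad_mpoly !comp_mpolyD comp_mpolyC !raddf_sum /=.
congr (_ + _ + _).
  rewrite (sum_kept (f := f)) => [|k k0]; last first.
    by rewrite comp_mpolyZ subst0 ?scaler0.
  by apply: eq_bigr => k _; rewrite comp_mpolyZ substE keptE.
rewrite (sum_kept (f := f)) => [|k k0]; last first.
  rewrite raddf_sum big1 // => l _.
  by rewrite /= comp_mpolyZ rmorphM /= subst0 // mul0r scaler0.
apply: eq_bigr => k _.
rewrite raddf_sum /= (sum_kept (f := f)) => [|l l0]; last first.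
  by rewrite comp_mpolyZ rmorphM /= [X in _ * X]subst0 // mulr0 scaler0.
by apply: eq_bigr => l _; rewrite comp_mpolyZ rmorphM /= !substE !keptE.
Qed.

(** * Return lengths of a pPDA and their recurrence *)

Lemma big_prod_pair (I J : finType) (V : nmodType) (F : I * J -> V) :
  \sum_x F x = \sum_i \sum_j F (i, j).
Proof. by rewrite pair_bigA; apply: eq_bigr => -[]. Qed.

Lemma big_bseq2 (G : finType) (V : nmodType) (F : {bseq 2 of G} -> V) :
  \sum_alpha F alpha =
  F [bseq] + \sum_Y F [bseq Y] + \sum_Y \sum_X F [bseq Y; X].
Proof.
pose f (x : unit + (G + G * G)) : {bseq 2 of G} :=
  match x with
  | inl _ => [bseq] | inr (inl Y) => [bseq Y] | inr (inr (Y, X)) => [bseq Y; X]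
  end.
pose g (s : {bseq 2 of G}) : unit + (G + G * G) :=
  match val s with
  | [::] => inl tt | [:: Y] => inr (inl Y) | Y :: X :: _ => inr (inr (Y, X))
  end.
have fK : cancel f g by case=> [[]|[Y|[Y X]]].
have gK : cancel g f.
  by case=> -[|Y [|X [|? ?]]] //= i; apply: val_inj.
rewrite (reindex f) /=; last by exists g => x _.
rewrite !big_sumType /= -addrA; congr (_ + (_ + _)).
  by rewrite (big_pred1 tt) // => -[].
by rewrite pair_big /=; apply: eq_bigr => -[].
Qed.

Section Runs.
Variables (R : realType) (Q G : finType) (D : pPDA Q G).

Local Notation J := (Q * G * Q)%type.

Let a p Z r alpha : R := ratr (weight D p Z r alpha).

Let a_ge0 p Z r alpha : 0 <= a p Z r alpha.
Proof. by rewrite /a ler0q weight_ge0. Qed.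

(** First-step recursion for the probability of reaching the empty stack in state [q] after exactly
    n steps; [sum_runs] relates it to paths. *)
Fixpoint reach (n : nat) (x : config Q G) (q : Q) : R :=
  match n, x.2 with
  | 0%N, [::] => (x.1 == q)%:R
  | n'.+1, Z :: beta =>
      \sum_r \sum_alpha a x.1 Z r alpha * reach n' (r, val alpha ++ beta) q
  | _, _ => 0
  end.

Lemma reach_ge0 n x q : 0 <= reach n x q.
Proof.
elim: n x => [|n IH] [p [|Z beta]] //=; rewrite sumr_ge0 // => r _.
by rewrite sumr_ge0 // => alpha _; rewrite mulr_ge0.
Qed.

Lemma reach_nil n p q : reach n (p, [::]) q = (n == 0%N)%:R * (p == q)%:R.
Proof. by case: n => [|n] /=; rewrite ?mul1r ?mul0r. Qed.

(** A run clearing alpha ++ beta first uncovers beta, in some state t after i steps; the rest is a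
    run clearing beta. *)
Lemma reach_cat n p alpha beta q : reach n (p, alpha ++ beta) q =
  \sum_t \sum_(i < n.+1) reach i (p, alpha) t * reach (n - i) (t, beta) q.
Proof.
elim: n p alpha => [|n IH] p [|Z alpha] /=.
- rewrite (bigD1 p) //= [X in _ + X]big1 ?addr0 => [|t /negPf pt].
    by rewrite big_ord1 /= eqxx mul1r.
  by rewrite big_ord1 /= eq_sym pt mul0r.
- by rewrite big1 // => t _; rewrite big_ord1 /= mul0r.
- rewrite (bigD1 p) //= [X in _ + X]big1 ?addr0 => [|t /negPf pt].
    rewrite big_ord_recl /= eqxx mul1r big1 ?addr0 // => i _.
    by rewrite mul0r.
  rewrite big_ord_recl /= eq_sym pt mul0r big1 ?addr0 // => i _.
  by rewrite mul0r.
under [RHS]eq_bigr => t _.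
  rewrite big_ord_recl /= mul0r add0r.
  under eq_bigr => i _ do rewrite subSS mulr_suml.
  rewrite exchange_big /=.
  over.
rewrite [RHS]exchange_big /=; apply: eq_bigr => r _.
under [RHS]eq_bigr => t _ do
  (under eq_bigr => i _ do rewrite mulr_suml; rewrite exchange_big /=).
rewrite [RHS]exchange_big /=; apply: eq_bigr => gamma _.
rewrite catA IH mulr_sumr; apply: eq_bigr => t _.
by rewrite mulr_sumr; apply: eq_bigr => i _; rewrite mulrA.
Qed.

(** Averaging over the first transition preserves the bound because the weights sum to 1; the empty
    stack contributes only at n = 0. *)
Lemma reach_total_le1 N x : \sum_q \sum_(n < N) reach n x q <= 1.
Proof.
elim: N x => [|N IH] [p [|Z beta]].
- by rewrite big1 // => q _; rewrite big_ord0.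
- by rewrite big1 // => q _; rewrite big_ord0.
- rewrite (bigD1 p) //= [X in _ + X]big1 ?addr0 => [|t /negPf pt].
    by rewrite big_ord_recl /= eqxx big1 ?addr0.
  by rewrite big_ord_recl /= eq_sym pt big1 ?addr0.
under eq_bigr => q _.
  rewrite big_ord_recl /= add0r exchange_big /=.
  under eq_bigr => r _ do rewrite exchange_big /=.
  over.
rewrite exchange_big /=.
under eq_bigr => r _ do rewrite exchange_big /=.
have <- : \sum_r \sum_alpha a p Z r alpha = 1.
  have := congr1 (@ratr R) (delta_sum1 D p Z).
  rewrite rmorph1 rmorph_sum /= => <-; apply: eq_bigr => r _.
  by rewrite rmorph_sum.
apply: ler_sum => r _; apply: ler_sum => alpha _.
under eq_bigr => q _ do rewrite -mulr_sumr.
by rewrite -mulr_sumr ler_piMr.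
Qed.

Definition fund_const (j : J) : R := let: (p, Z, q) := j in a p Z q [bseq].

Definition fund_lin (j k : J) : R :=
  let: (p, Z, q) := j in let: (r, Y, s) := k in
  if s == q then a p Z r [bseq Y] else 0.

(** Spreads \sum_t x_rYt x_tXq over all pairs of indices: the guard requires a common middle state
    and the final state q. *)
Definition fund_quad (j k l : J) : R :=
  let: (p, Z, q) := j in let: (r, Y, t) := k in let: (t', X, s) := l in
  if (t' == t) && (s == q) then a p Z r [bseq Y; X] else 0.

Lemma fund_const_ge0 j : 0 <= fund_const j.
Proof. by case: j => [[p Z] q] /=. Qed.

Lemma fund_lin_ge0 j k : 0 <= fund_lin j k.
Proof. by case: j k => [[p Z] q] [[r Y] s] /=; case: ifP. Qed.

Lemma fund_quad_ge0 j k l : 0 <= fund_quad j k l.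
Proof.
by case: j k l => [[p Z] q] [[r Y] t] [[t' X] s] /=; case: ifP.
Qed.

(** An arbitrary module [V] covers both polynomials and, as [R^o], real numbers. *)
Lemma fund_lin_sum (V : lmodType R) p Z q (F : J -> V) :
  \sum_k fund_lin (p, Z, q) k *: F k =
  \sum_r \sum_Y a p Z r [bseq Y] *: F (r, Y, q).
Proof.
rewrite !big_prod_pair; apply: eq_bigr => r _; apply: eq_bigr => Y _ /=.
rewrite (bigD1 q) //= eqxx big1 ?addr0 // => s /negPf ->.
by rewrite scale0r.
Qed.

Lemma fund_quad_sum (V : lmodType R) p Z q (F : J -> J -> V) :
  \sum_k \sum_l fund_quad (p, Z, q) k l *: F k l =
  \sum_r \sum_Y \sum_X
    a p Z r [bseq Y; X] *: \sum_t F (r, Y, t) (t, X, q).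
Proof.
rewrite !big_prod_pair; apply: eq_bigr => r _; apply: eq_bigr => Y _.
under [RHS]eq_bigr => X _ do rewrite scaler_sumr.
rewrite [RHS]exchange_big /=; apply: eq_bigr => t _.
rewrite !big_prod_pair (bigD1 t) //= [X in _ + X]big1 ?addr0.
  apply: eq_bigr => X _; rewrite (bigD1 q) //= !eqxx big1 ?addr0 //.
  by move=> s /negPf ->; rewrite scale0r.
move=> t' /negPf t't.
by rewrite big1 // => X _; rewrite big1 // => s _; rewrite t't scale0r.
Qed.

Lemma fundamental_quad_mpoly j :
  fundamental R D j = quad_mpoly fund_const fund_lin fund_quad j.
Proof.
case: j => [[p Z] q]; rewrite /quad_mpoly fund_lin_sum.
by rewrite (fund_quad_sum p Z q (fun k l => pvar R k * pvar R l)).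
Qed.

Definition len_prob (n : nat) (j : J) : R :=
  let: (p, Z, q) := j in reach n (p, [:: Z]) q.

Lemma len_prob_ge0 n j : 0 <= len_prob n j.
Proof. by case: j => [[p Z] q]; exact: reach_ge0. Qed.

Lemma len_prob0 j : len_prob 0 j = 0.
Proof. by case: j => [[]]. Qed.

Lemma len_probS n j : len_prob n.+1 j =
  (if n is 0%N then fund_const j else 0)
  + \sum_k fund_lin j k * len_prob n k
  + \sum_k \sum_l fund_quad j k l *
      \sum_(i < n.+1) len_prob i k * len_prob (n - i) l.
Proof.
case: j => [[p Z] q].
rewrite (fund_lin_sum p Z q (fun k => len_prob n k : R^o)).
rewrite (fund_quad_sum p Z q (fun k l =>
  (\sum_(i < n.+1) len_prob i k * len_prob (n - i) l) : R^o)) /=.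
under eq_bigr => r _ do rewrite big_bseq2 /=.
rewrite !big_split /=; congr (_ + _ + _).
  rewrite (bigD1 q) //= reach_nil eqxx mulr1 big1 ?addr0 => [|r /negPf rq].
    by case: n => [|n]; rewrite ?mulr1 ?mulr0.
  by rewrite reach_nil rq !mulr0.
apply: eq_bigr => r _; apply: eq_bigr => Y _; apply: eq_bigr => X _.
(* A push splits the run at the moment when X is uncovered. *)
by rewrite -[ [:: Y; X] ]/([:: Y] ++ [:: X]) reach_cat.
Qed.

Lemma psum_len_prob_le1 N j : psum len_prob 1 N j <= 1.
Proof.
case: j => [[p Z] q]; apply: le_trans (reach_total_le1 N (p, [:: Z])).
have -> : psum (len_prob) 1 N (p, Z, q) = \sum_(n < N) reach n (p, [:: Z]) q.
  by apply: eq_bigr => n _; rewrite expr1n mul1r.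
rewrite (bigD1 q) //= lerDl sumr_ge0 // => r _; rewrite sumr_ge0 // => n _.
exact: reach_ge0.
Qed.

End Runs.

(** * Sums over return paths grouped by length *)

Section ReturnPaths.
Variables (R : realType) (Q G : finType) (D : pPDA Q G).

Local Notation J := (Q * G * Q)%type.
Local Notation config := (config Q G).

(** Configurations form an infinite type; a duplicate-free list of successors makes one-step sums
    finite. *)
Definition succs (x : config) : seq config :=
  if x.2 is Z :: beta then
    [seq (y.1, val y.2 ++ beta) | y <- enum {: Q * {bseq 2 of G}}
                                & isSome (delta D x.1 Z y.1 y.2)]
  else [::].

Lemma mem_succs x y : (y \in succs x) = step D x y.
Proof.
case: x => [p [|Z beta]] //=; rewrite /succs /step /=.
apply/mapP/existsP => [[[r alpha]]|[alpha /andP[/eqP ya dy]]].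
  by rewrite mem_filter /= => /andP[d _] ->; exists alpha; rewrite eqxx.
exists (y.1, alpha); first by rewrite mem_filter /= dy mem_enum.
by rewrite -ya -surjective_pairing.
Qed.

Lemma cat_bseq_inj (alpha alpha' : {bseq 2 of G}) beta :
  (val alpha ++ beta == val alpha' ++ beta) = (alpha == alpha').
Proof.
apply/eqP/eqP => [E|-> //]; apply: val_inj => /=.
have sE : size (val alpha) = size (val alpha').
  by apply: (@addIn (size beta)); rewrite -!size_cat E.
by move/eqP: E; rewrite eqseq_cat // => /andP[/eqP].
Qed.

Lemma uniq_succs x : uniq (succs x).
Proof.
case: x => [p [|Z beta]] //; rewrite /succs /= map_inj_uniq.
  by rewrite filter_uniq // enum_uniq.
move=> [r alpha] [r' alpha'] /= [-> /eqP]; rewrite cat_bseq_inj => /eqP -> //.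
Qed.

(** The pushed word is determined by the successor, so transitions and successors correspond; absent
    transitions have weight 0. *)
Lemma sum_succs p Z beta (h : config -> R) :
  \sum_(y <- succs (p, Z :: beta)) ratr (step_prob D (p, Z :: beta) y) * h y =
  \sum_r \sum_alpha ratr (weight D p Z r alpha) * h (r, val alpha ++ beta).
Proof.
rewrite pair_bigA /succs /= big_map big_filter big_enum_cond /=.
rewrite big_mkcond /=; apply: eq_bigr => -[r alpha] _ /=.
rewrite /step_prob /= (eq_bigl (pred1 alpha)) => [|gamma]; last first.
  by rewrite /= cat_bseq_inj eq_sym.
rewrite big_pred1_eq; case: ifP => //.
by rewrite /weight; case: delta => //= _; rewrite rmorph0 mul0r.
Qed.

Fixpoint runs (n : nat) (x : config) (q : Q) : seq (seq config) :=
  if n is n'.+1 then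
    flatten [seq [seq y :: w | w <- runs n' y q] | y <- succs x]
  else if x == (q, [::]) then [:: [::]] else [::].

Lemma mem_runs n x q w : (w \in runs n x q) =
  [&& size w == n, path (step D) x w & last x w == (q, [::])].
Proof.
elim: n x w => [|n IH] x w /=.
  by case: w => [|y w]; case: ifP => //= ->.
apply/flattenP/idP => [[_ /mapP[y ys ->] /mapP[v vr ->]]|].
  by move: vr; rewrite IH /= eqSS -mem_succs ys => /and3P[-> -> ->].
case: w => [|y w] //=; rewrite eqSS => /and3P[sw /andP[xy yw] lw].
exists [seq y :: v | v <- runs n y q]; first by apply: map_f; rewrite mem_succs.
by apply: map_f; rewrite IH sw yw lw.
Qed.

Lemma uniq_runs n x q : uniq (runs n x q).
Proof.
elim: n x => [|n IH] x /=; first by case: ifP.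
elim: (succs x) (uniq_succs x) => [|y s IHs] //= /andP[ys us].
rewrite cat_uniq IHs // andbT map_inj_uniq => [|v w [] //]; rewrite IH /=.
apply/hasPn => w /flattenP[_ /mapP[z zs ->] /mapP[v _ ->]].
by apply/negP => /mapP[v' _ [zy _]]; rewrite -zy zs in ys.
Qed.

Lemma sum_runs n x q :
  \sum_(w <- runs n x q) ratr (path_prob D x w) = reach R D n x q.
Proof.
elim: n x => [|n IH] [p [|Z beta]] /=.
- rewrite xpair_eqE eqxx andbT; case: ifP => _; last by rewrite big_nil.
  by rewrite big_seq1 rmorph1.
- by rewrite xpair_eqE andbF big_nil.
- by rewrite big_nil.
rewrite -(sum_succs p Z beta (fun y => reach R D n y q)) big_flatten big_map.
apply: eq_bigr => y _.
rewrite big_map -IH mulr_sumr; apply: eq_bigr => w _.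
by rewrite /= rmorphM.
Qed.

Lemma path_prob_ge0 x w : 0 <= path_prob D x w.
Proof.
elim: w x => [|y w IH] x //=; rewrite mulr_ge0 // /step_prob.
case: x.2 => // Z beta; rewrite sumr_ge0 // => alpha _; exact: weight_ge0.
Qed.

(** The return paths are the disjoint union over n of the finite sets [runs n], and nonnegative sums
    may be regrouped. Taking phi = 1 gives the return probability, phi n = n the moment. *)
Lemma esum_return_paths (phi : nat -> R) p Z q : (forall n, 0 <= phi n) ->
  (\esum_(w in return_paths D p Z q)
     (ratr (path_prob D (p, [:: Z]) w) * phi (size w))%:E =
   \sum_(0 <= n <oo) (phi n * len_prob R D n (p, Z, q))%:E)%E.
Proof.
move=> phi0.
pose F w := (ratr (path_prob D (p, [:: Z]) w) * phi (size w))%:E : \bar R.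
have F0 w : (0 <= F w)%E.
  by rewrite lee_fin mulr_ge0 // ler0q path_prob_ge0.
pose S n := [set` runs n (p, [:: Z]) q]%classic.
have -> : return_paths D p Z q = (\bigcup_n S n)%classic.
  apply/seteqP; split => w /=.
    case=> pw lw; exists (size w) => //; rewrite /S /=.
    by rewrite mem_runs eqxx pw lw eqxx.
  by case=> n _; rewrite /S /= mem_runs => /and3P[_ pw /eqP].
rewrite esum_bigcupT //; last first.
  apply/trivIsetP => m n _ _ mn; apply/seteqP; split => w // []; rewrite /S /=.
  rewrite !mem_runs => /and3P[/eqP sm _ _] /and3P[/eqP sn _ _].
  by rewrite -sm -sn eqxx in mn.
rewrite nneseries_esumT; last first.
  by move=> n; rewrite lee_fin mulr_ge0 // len_prob_ge0.
apply: eq_esum => n _.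
rewrite esum_fset; last 2 first.
- exact: finite_seq.
- by move=> w _; exact: F0.
rewrite /S -fsbig_seq ?uniq_runs //.
rewrite /len_prob -sum_runs mulr_sumr -sumEFin big_seq [RHS]big_seq.
apply: eq_bigr => w; rewrite mem_runs => /and3P[/eqP <- _ _].
by rewrite /F mulrC.
Qed.

End ReturnPaths.

(** * Least fixed points of quadratic systems *)

Lemma mu_unique (R : realType) (J : finType) (f : pps R J) u :
  is_lfp f u -> mu f = u.
Proof.
move=> [u0 fu umin]; have [m0 fm mmin] := muP f.
apply/funext => j; apply/le_anti/andP; split; [exact: mmin|exact: umin].
Qed.

Section QuadraticPps.
Variables (R : realType) (J : finType) (f : pps R J).
Variables (c : J -> R) (L : J -> J -> R) (B : J -> J -> J -> R).
Variable T : nat -> J -> R.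
Hypotheses (c_ge0 : forall j, 0 <= c j) (L_ge0 : forall j k, 0 <= L j k).
Hypothesis B_ge0 : forall j k l, 0 <= B j k l.
Hypothesis fE : forall j, f j = quad_mpoly c L B j.
Hypothesis T_ge0 : forall n j, 0 <= T n j.
Hypothesis T0 : forall j, T 0%N j = 0.
Hypothesis TS : forall n j, T n.+1 j = (if n is 0%N then c j else 0)
  + \sum_k L j k * T n k
  + \sum_k \sum_l B j k l * \sum_(i < n.+1) T i k * T (n - i)%N l.
Hypothesis psum_le1 : forall N j, psum T 1 N j <= 1.

Lemma pps_fun_quad (x : J -> R) j :
  pps_fun f (EFin \o x) j = (qmap c L B x j)%:E.
Proof. by rewrite /pps_fun -meval_quad_mpoly -fE -eeval_EFin. Qed.

(** W(1) is a fixed point by [wsum_fix]. It is least since, by induction, psum (N + 1) <= qmap (psum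
    N) <= f(v) = v for every nonnegative fixed point v. *)
Lemma mu_quad : mu f = EFin \o wsum T 1.
Proof.
apply: mu_unique; split=> [j||v v0 fv j].
- by rewrite lee_fin wsum_ge0.
- apply/funext => j; rewrite pps_fun_quad /=; congr (_%:E).
  by rewrite [RHS](wsum_fix c_ge0 L_ge0 B_ge0) // mul1r.
have le_v N k : ((psum T 1 N k)%:E <= v k)%E.
  elim: N k => [|N IH] k; first by rewrite psum0.
  apply: (@le_trans _ _ (pps_fun f (EFin \o psum T 1 N) k)).
    rewrite pps_fun_quad lee_fin.
    have := psum_le_qmap c_ge0 L_ge0 B_ge0 T_ge0 T0 TS ler01 N k.
    by rewrite mul1r.
  have <- : pps_fun f v k = v k by rewrite fv.
  apply: pps_fun_le => // i.
  by rewrite lee_fin psum_ge0.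
have := le_v ^~ j; have := v0 j; case: (v j) => [r _ vr|_ _|//].
  by rewrite lee_fin; apply: wsum_le => // N; rewrite -lee_fin.
exact: leey.
Qed.

End QuadraticPps.

(** * Non-singularity of the cleaned-up system and bounded moments *)

Section CleanedSystem.
Variables (R : realType) (J : finType) (f : pps R J).
Variables (c : J -> R) (L : J -> J -> R) (B : J -> J -> J -> R).
Variable T : nat -> J -> R.
Hypotheses (c_ge0 : forall j, 0 <= c j) (L_ge0 : forall j k, 0 <= L j k).
Hypothesis B_ge0 : forall j k l, 0 <= B j k l.
Hypothesis fE : forall j, f j = quad_mpoly c L B j.
Hypothesis T_ge0 : forall n j, 0 <= T n j.
Hypothesis T0 : forall j, T 0%N j = 0.
Hypothesis TS : forall n j, T n.+1 j = (if n is 0%N then c j else 0)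
  + \sum_k L j k * T n k
  + \sum_k \sum_l B j k l * \sum_(i < n.+1) T i k * T (n - i)%N l.
Hypothesis psum_le1 : forall N j, psum T 1 N j <= 1.

Let muE := mu_quad c_ge0 L_ge0 B_ge0 fE T_ge0 T0 TS psum_le1.

Let K : finType := kept f.
Let c' (j : K) := c (val j).
Let L' (j k : K) := L (val j) (val k).
Let B' (j k l : K) := B (val j) (val k) (val l).
Let T' n (j : K) := T n (val j).

Let c'_ge0 j : 0 <= c' j. Proof. exact: c_ge0. Qed.
Let L'_ge0 j k : 0 <= L' j k. Proof. exact: L_ge0. Qed.
Let B'_ge0 j k l : 0 <= B' j k l. Proof. exact: B_ge0. Qed.
Let T'_ge0 n j : 0 <= T' n j. Proof. exact: T_ge0. Qed.
Let T'0 j : T' 0%N j = 0. Proof. exact: T0. Qed.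

(** A nonnegative series with sum 0 has zero terms; hence the restriction of [T] to kept indices
    still satisfies the recurrence. *)
Let T_kept n k : mu f k = 0%E -> T n k = 0.
Proof.
rewrite muE => -[Wk]; apply/le_anti; rewrite T_ge0 andbT -Wk.
apply: le_trans (psum_le_wsum T_ge0 psum_le1 ler01 (lexx 1) n.+1 k).
by rewrite /psum big_ord_recr /= expr1n mul1r lerDr psum_ge0.
Qed.

Let T'S n j : T' n.+1 j = (if n is 0%N then c' j else 0)
  + \sum_k L' j k * T' n k
  + \sum_k \sum_l B' j k l * \sum_(i < n.+1) T' i k * T' (n - i)%N l.
Proof.
rewrite /T' TS; congr (_ + _ + _).
  by rewrite (sum_kept (f := f)) // => k /T_kept ->; rewrite mulr0.
rewrite (sum_kept (f := f)) => [|k k0]; last first.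
  rewrite big1 // => l _; rewrite big1 ?mulr0 // => i _.
  by rewrite T_kept ?mul0r.
apply: eq_bigr => k _; rewrite (sum_kept (f := f)) // => l l0.
by rewrite big1 ?mulr0 // => i _; rewrite (T_kept _ l0) mulr0.
Qed.

Let psum'_le1 N j : psum T' 1 N j <= 1.
Proof. exact: psum_le1. Qed.

Let fE' (j : K) : cleanup f j = quad_mpoly c' L' B' j.
Proof. exact: cleanup_quad_mpoly. Qed.

(** [moment_bounded] with the inverse matrix as [V] gives one direction; [qjac_kernel_trivial] gives
    the other, as a square matrix with trivial kernel is invertible. *)
Lemma nonsingular_cleanup : nonsingular (cleanup f) <->
  forall j, mu f j != 0%E -> exists C, forall N, moment T N j <= C.
Proof.
pose W := wsum T' 1.
have muW j : fine (mu (cleanup f) j) = W j.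
  by rewrite (mu_quad c'_ge0 L'_ge0 B'_ge0 fE' T'_ge0 T'0 T'S psum'_le1).
pose M : 'M[R]_#|K| := 1%:M - jacobi (cleanup f) (fine \o mu (cleanup f)).
(* M acts as x - A x once matrix indices are translated by [enum_rank]. *)
have ME (v : 'cV[R]_#|K|) i : (M *m v) i 0 =
    v i 0 - \sum_(k : K) qjac L' B' W (enum_val i) k * v (enum_rank k) 0.
  rewrite mulmxBl mul1mx !mxE; congr (_ - _).
  rewrite (reindex (@enum_rank K)) /=; last first.
    by apply: onW_bij; exact: enum_rank_bij.
  apply: eq_bigr => k _; rewrite !mxE; congr (_ * _).
  rewrite -(meval_mderiv_quad_mpoly c') -fE'; apply: meval_eq => m /=.
  by rewrite muW.
rewrite /nonsingular -/M; split=> [Mu j j0|bounded].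
  have [|C CP] := moment_bounded c'_ge0 L'_ge0 B'_ge0 T'_ge0 T'0 T'S psum'_le1
    (V := fun i j => invmx M (enum_rank i) (enum_rank j)); last first.
  - by exists C => N; exact: (CP N (Sub j j0 : K)).
  - move=> x i; pose v : 'cV[R]_#|K| := \col_i x (enum_val i).
    have : v (enum_rank i) 0 = (invmx M *m (M *m v)) (enum_rank i) 0.
      by rewrite mulKmx.
    rewrite {1}mxE enum_rankK => ->; rewrite mxE.
    rewrite (reindex (@enum_rank K)) /=; last first.
      by apply: onW_bij; exact: enum_rank_bij.
    apply: eq_bigr => k _; rewrite ME mxE enum_rankK; congr (_ * (_ - _)).
    by apply: eq_bigr => l _; rewrite mxE enum_rankK.
(* [inj_row_free] concerns row vectors, hence the transpose. *)
rewrite -unitmx_tr -row_free_unit; apply: inj_row_free => v vM.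
have Mv : M *m v^T = 0 by rewrite -[M]trmxK -trmx_mul vM trmx0.
have [C CP] : exists C : K -> R, forall N j, moment T' N j <= C j.
  have [C CP] := choice (fun j : K => bounded (val j) (valP j)).
  by exists C => N j; exact: CP.
have x0 : forall j : K, v 0 (enum_rank j) = 0.
  apply: (qjac_kernel_trivial c'_ge0 L'_ge0 B'_ge0 T'_ge0 T'0 T'S psum'_le1
    _ CP).
  (* Kept indices are exactly those where W(1) is nonzero. *)
  - move=> j; rewrite lt_neqAle eq_sym wsum_ge0 // andbT.
    apply: contra_neq (valP j) => Wj.
    by rewrite -[RHS]/(0%:E) -Wj; exact: (congr1 (fun u => u (val j)) muE).
  move=> j; have := ME v^T (enum_rank j); rewrite Mv !mxE enum_rankK.
  move/esym/eqP; rewrite subr_eq0 => /eqP ->.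
  by apply: eq_bigr => k _; rewrite mxE.
by apply/rowP => i; rewrite mxE -[i]enum_valK x0.
Qed.

End CleanedSystem.

(** * From bounded truncated moments to finite conditional termination moments *)

Theorem theorem6 (R : realType) (Q G : finType) (D : pPDA Q G) :
  nonsingular (cleanup (fundamental R D)) <-> cPAST R D.
Proof.
pose T := len_prob R D.
have T_ge0 := @len_prob_ge0 R Q G D.
have T_le1 := @psum_len_prob_le1 R Q G D.
have muE := mu_quad (@fund_const_ge0 R Q G D) (@fund_lin_ge0 R Q G D)
  (@fund_quad_ge0 R Q G D) (@fundamental_quad_mpoly R Q G D) T_ge0
  (@len_prob0 R Q G D) (@len_probS R Q G D) T_le1.
apply: (iff_trans (nonsingular_cleanup (@fund_const_ge0 R Q G D)
  (@fund_lin_ge0 R Q G D) (@fund_quad_ge0 R Q G D)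
  (@fundamental_quad_mpoly R Q G D) T_ge0
  (@len_prob0 R Q G D) (@len_probS R Q G D) T_le1)).
(* Grouping paths by length identifies return probabilities with W(1) and, next, termination moments
   with limits of truncated moments. *)
have returnE p Z q : return_prob R D p Z q = (wsum T 1 (p, Z, q))%:E.
  rewrite -EFin_lim; last exact: psum_cvg.
  rewrite /return_prob; under eq_esum do rewrite -[ratr _]mulr1.
  rewrite (esum_return_paths D (phi := fun=> 1)) //.
  congr (limn _); apply/funext => N /=.
  rewrite sumEFin /psum big_mkord; congr (_%:E).
  by apply: eq_bigr => n _; rewrite expr1n.
have momentE p Z q : term_moment R D p Z q =
    limn (fun N => (moment T N (p, Z, q))%:E).
  rewrite /term_moment (esum_return_paths D (phi := fun n => n%:R)) //.
  congr (limn _); apply/funext => N /=.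
  by rewrite sumEFin /moment big_mkord.
have moment_cvg j : cvgn (fun N => (moment T N j)%:E).
  apply: ereal_nondecreasing_is_cvgn => m n mn.
  by rewrite lee_fin moment_homo.
split=> [fin p Z q r0|past [[p Z] q] j0].
  rewrite returnE in r0 *; rewrite lte_fin in r0.
  have [|C CP] := fin (p, Z, q); first by rewrite muE /= eqe gt_eqF.
  have ME : (term_moment R D p Z q <= C%:E)%E.
    rewrite momentE; apply: lime_le; first exact: moment_cvg.
    by apply: nearW => N; rewrite lee_fin.
  rewrite inver gt_eqF //; apply: le_lt_trans (lee_wpmul2r _ ME) _.
    by rewrite lee_fin invr_ge0 ltW.
  by rewrite -EFinM ltry.
have w0 : (0 < wsum T 1 (p, Z, q)).
  rewrite muE /= eqe in j0.
  by rewrite lt_neqAle eq_sym j0 wsum_ge0.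
have := past p Z q; rewrite returnE lte_fin => /(_ w0).
(* Dividing by a positive real does not affect finiteness: the bound becomes +oo * W(1) = +oo. *)
rewrite inver gt_eqF // lte_pdivrMr // gt0_mulye ?lte_fin // momentE => fin.
have le_lim N : ((moment T N (p, Z, q))%:E <=
    limn (fun N => (moment T N (p, Z, q))%:E))%E.
  apply: lime_ge; first exact: moment_cvg.
  by exists N => // n /= Nn; rewrite lee_fin moment_homo.
(* The limit is nonnegative and below +oo, so [fine] returns its value and not the default 0. *)
exists (fine (limn (fun N => (moment T N (p, Z, q))%:E))) => N.
rewrite -lee_fin fineK ?le_lim // ge0_fin_numE //.
by apply: le_trans (le_lim 0%N); rewrite lee_fin moment_ge0.
Qed.
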